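(* There exist a $C^*$-algebra $\mathfrak{A}$, a Hilbert $\mathfrak{A}$-module $H$ and projections $P,Q\in\mathcal{L}(H)$ such that $\mathcal{R}:=\mathcal{R}(Q)\cap\mathcal{R}(P)=\{0\}$ and $\mathcal{N}:=\mathcal{N}(Q)\cap\mathcal{N}(P)=\{0\}$, whereas there is no unitary $U\in\mathcal{L}(H)$ satisfying both $$U(Q-P_{\mathcal{R}})U^*=I-P-P_{\mathcal{N}}\quad\text{and}\quad U(P-P_{\mathcal{R}})U^*=I-Q-P_{\mathcal{N}}.$$
   Context: For a Hilbert $C^*$-module $H$, $\mathcal{L}(H)$ denotes the $C^*$-algebra of all adjointable operators on $H$, and $I$ its unit. A projection is $P\in\mathcal{L}(H)$ with $P=P^*=P^2$. $\mathcal{R}(T)$ and $\mathcal{N}(T)$ denote the range and null space of $T$. For an orthogonally complemented closed submodule $M$ of $H$ (i.e. $H=M+M^\perp$), $P_M\in\mathcal{L}(H)$ denotes the projection with range $M$; in particular $P_{\{0\}}=0$. *)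

(* Defs.v *)
From HB Require Import structures.
From mathcomp Require Import all_boot all_order all_algebra.
From mathcomp Require Import complex.
From mathcomp Require Import all_classical all_reals all_analysis.

Set Implicit Arguments.
Unset Strict Implicit.
Unset Printing Implicit Defensive.

Import Order.TTheory GRing.Theory Num.Theory numFieldNormedType.Exports.

Local Open Scope classical_set_scope.
Local Open Scope ring_scope.

(* The product is a field of the mixin, and not that of a ring structure,
   because a C*-algebra need not have a unit and MathComp rings do. *)
HB.mixin Record isCstarAlgebra (R : realType) A
    of CompleteNormedModule R[i] A := {
  cmul : A -> A -> A;
  cstar : A -> A;
  cmulA : forall a b c, cmul a (cmul b c) = cmul (cmul a b) c;
  cmulDl : forall a b c, cmul (a + b) c = cmul a c + cmul b c;
  cmulDr : forall a b c, cmul a (b + c) = cmul a b + cmul a c;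
  cscalerAl : forall (k : R[i]) a b, k *: cmul a b = cmul (k *: a) b;
  cscalerAr : forall (k : R[i]) a b, k *: cmul a b = cmul a (k *: b);
  cnormM : forall a b, `|cmul a b| <= `|a| * `|b|;
  cstarK : forall a, cstar (cstar a) = a;
  cstarD : forall a b, cstar (a + b) = cstar a + cstar b;
  cstarZ : forall (k : R[i]) a, cstar (k *: a) = k^* *: cstar a;
  cstarM : forall a b, cstar (cmul a b) = cmul (cstar b) (cstar a);
  cstar_norm : forall a, `|cmul (cstar a) a| = `|a| ^+ 2
}.

#[short(type="cstarAlgType")]
HB.structure Definition CstarAlgebra (R : realType) :=
  {A of isCstarAlgebra R A & CompleteNormedModule R[i] A}.

Definition cpositive (R : realType) (A : cstarAlgType R) (a : A) : Prop :=
  exists b : A, a = cmul (cstar b) b.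

(* Right module; the inner product is linear in its second variable. *)
HB.mixin Record isHilbertModule (R : realType) (A : cstarAlgType R) H
    of CompleteNormedModule R[i] H := {
  ract : H -> A -> H;
  inner : H -> H -> A;
  ractDl : forall x y a, ract (x + y) a = ract x a + ract y a;
  ractDr : forall x a b, ract x (a + b) = ract x a + ract x b;
  ractA : forall x a b, ract x (cmul a b) = ract (ract x a) b;
  ractZl : forall (k : R[i]) x a, k *: ract x a = ract (k *: x) a;
  ractZr : forall (k : R[i]) x a, k *: ract x a = ract x (k *: a);
  innerDr : forall x y z, inner x (y + z) = inner x y + inner x z;
  innerZr : forall (k : R[i]) x y, inner x (k *: y) = k *: inner x y;
  inner_ract : forall x y a, inner x (ract y a) = cmul (inner x y) a;
  inner_star : forall x y, cstar (inner x y) = inner y x;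
  inner_ge0 : forall x, cpositive (inner x x);
  inner_eq0 : forall x, inner x x = 0 -> x = 0;
  inner_norm : forall x, `|x| ^+ 2 = `|inner x x|
}.

#[short(type="hilbertModType")]
HB.structure Definition HilbertModule (R : realType) (A : cstarAlgType R) :=
  {H of isHilbertModule R A H & CompleteNormedModule R[i] H}.

Section InnerTheory.
Context {R : realType} {A : cstarAlgType R} {H : hilbertModType A}.
Implicit Types x y z : H.

Lemma innerDl x y z : inner (x + y) z = inner x z + inner y z :> A.
Proof. by rewrite -inner_star innerDr cstarD !inner_star. Qed.

Lemma inner0r x : inner x 0 = 0 :> A.
Proof. by rewrite -(scale0r 0) innerZr scale0r. Qed.

Lemma inner0l x : inner 0 x = 0 :> A.
Proof. by apply: (addIr (inner 0 x)); rewrite -innerDl !add0r. Qed.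

Lemma innerNr x y : inner x (- y) = - inner x y :> A.
Proof. by rewrite -scaleN1r innerZr scaleN1r. Qed.

Lemma innerNl x y : inner (- x) y = - inner x y :> A.
Proof. by apply: (addIr (inner x y)); rewrite -innerDl !addNr inner0l. Qed.

Lemma inner_inj x y : (forall z, inner z x = inner z y :> A) -> x = y.
Proof.
move=> e; apply/eqP; rewrite -subr_eq0; apply/eqP/inner_eq0.
by rewrite innerDr innerNr e subrr.
Qed.

End InnerTheory.

Section AdjointableOperators.
Context {R : realType} {A : cstarAlgType R} (H : hilbertModType A).

Definition adjoint_pair (T S : H -> H) : Prop :=
  forall x y, inner (T x) y = inner x (S y) :> A.

Record adjop : Type := AdjOp {
  adjop_fun :> H -> H;
  adjopP : exists S, adjoint_pair adjop_fun S
}.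

Lemma adjop_ext (S T : adjop) : S =1 T -> S = T.
Proof.
case: S T => [f pf] [g pg] /= /funext fg.
by case: _ / fg in pg *; rewrite (Prop_irrelevance pf pg).
Qed.

Lemma adjoint_pair_sym T S : adjoint_pair T S -> adjoint_pair S T.
Proof. by move=> TS x y; rewrite -inner_star -TS inner_star. Qed.

Definition adj (T : adjop) : adjop :=
  AdjOp (ex_intro _ (T : H -> H)
    (adjoint_pair_sym (projT2 (cid (adjopP T))))).

Lemma adjE (T : adjop) x y : inner (T x) y = inner x (adj T y) :> A.
Proof. exact: (projT2 (cid (adjopP T))). Qed.

Lemma adjEr (T : adjop) x y : inner x (T y) = inner (adj T x) y :> A.
Proof. by rewrite -inner_star adjE inner_star. Qed.

Lemma adjopD (T : adjop) x y : T (x + y) = T x + T y.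
Proof. by apply: (@inner_inj R A) => z; rewrite innerDr !adjEr innerDr. Qed.

Fact adjop0_subproof : exists S, adjoint_pair (fun=> 0) S.
Proof. by exists (fun=> 0) => x y; rewrite inner0l inner0r. Qed.

Fact adjop1_subproof : exists S, adjoint_pair id S.
Proof. by exists id. Qed.

Fact adjop_opp_subproof (T : adjop) : exists S, adjoint_pair (fun x => - T x) S.
Proof. by exists (fun x => - adj T x) => x y; rewrite innerNl innerNr adjE. Qed.

Fact adjop_add_subproof (S T : adjop) :
  exists U, adjoint_pair (fun x => S x + T x) U.
Proof.
by exists (fun x => adj S x + adj T x) => x y; rewrite innerDl innerDr !adjE.
Qed.

Fact adjop_mul_subproof (S T : adjop) : exists U, adjoint_pair (S \o T) U.
Proof. by exists (adj T \o adj S) => x y /=; rewrite !adjE. Qed.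

Definition adjop0 := AdjOp adjop0_subproof.
Definition adjop1 := AdjOp adjop1_subproof.
Definition adjop_opp T := AdjOp (adjop_opp_subproof T).
Definition adjop_add S T := AdjOp (adjop_add_subproof S T).
Definition adjop_mul S T := AdjOp (adjop_mul_subproof S T).

HB.instance Definition _ := gen_eqMixin adjop.
HB.instance Definition _ := gen_choiceMixin adjop.

Fact adjop_addA : associative adjop_add.
Proof. by move=> S T U; apply: adjop_ext => x /=; rewrite addrA. Qed.

Fact adjop_addC : commutative adjop_add.
Proof. by move=> S T; apply: adjop_ext => x /=; rewrite addrC. Qed.

Fact adjop_add0 : left_id adjop0 adjop_add.
Proof. by move=> T; apply: adjop_ext => x /=; rewrite add0r. Qed.

Fact adjop_addN : left_inverse adjop0 adjop_opp adjop_add.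
Proof. by move=> T; apply: adjop_ext => x /=; rewrite addNr. Qed.

HB.instance Definition _ :=
  GRing.isZmodule.Build adjop adjop_addA adjop_addC adjop_add0 adjop_addN.

Fact adjop_mulA : associative adjop_mul.
Proof. by move=> S T U; apply: adjop_ext. Qed.

Fact adjop_mul1l : left_id adjop1 adjop_mul.
Proof. by move=> T; apply: adjop_ext. Qed.

Fact adjop_mul1r : right_id adjop1 adjop_mul.
Proof. by move=> T; apply: adjop_ext. Qed.

Fact adjop_mulDl : left_distributive adjop_mul adjop_add.
Proof. by move=> S T U; apply: adjop_ext. Qed.

Fact adjop_mulDr : right_distributive adjop_mul adjop_add.
Proof. by move=> S T U; apply: adjop_ext => x /=; rewrite adjopD. Qed.

(* Possibly the zero ring, when H = 0. *)
HB.instance Definition _ := GRing.Zmodule_isPzRing.Build adjop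
  adjop_mulA adjop_mul1l adjop_mul1r adjop_mulDl adjop_mulDr.

Definition null_space (T : adjop) : set H := [set x | T x = 0].

Definition projection (P : adjop) : Prop := P = adj P /\ P = P * P.

Definition unitary (U : adjop) : Prop := adj U * U = 1 /\ U * adj U = 1.

(* P_M; the value 0 is a dummy when M is not the range of a projection,
   that is, when M is not an orthogonally complemented closed submodule. *)
Definition proj_on (M : set H) : adjop :=
  xget 0 [set P | projection P /\ range P = M].

Lemma projection_inj (P Q : adjop) :
  projection P -> projection Q -> range P = range Q -> P = Q.
Proof.
have absorb (S T : adjop) :
    projection T -> range S = range T -> T * S = S.
  move=> [_ TT] ST; apply: adjop_ext => x.
  have [y _ Sx] : range T (S x) by rewrite -ST; exists x.
  by rewrite -[LHS]/(T (S x)) -Sx [in RHS]TT.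
move=> pP pQ PQ.
have QP := absorb _ _ pQ PQ; have {absorb} PQ' := absorb _ _ pP (esym PQ).
apply: adjop_ext => x; apply: (@inner_inj R A) => z.
by rewrite -{1}QP -[(Q * P) x]/(Q (P x)) adjEr -pQ.1 adjEr -pP.1
  -[P (Q z)]/((P * Q) z) PQ' adjEr -pQ.1.
Qed.

Lemma proj_onE (P : adjop) : projection P -> proj_on (range P) = P.
Proof.
move=> pP; apply: xget_unique; first by split.
by move=> Q [pQ QP]; apply: projection_inj.
Qed.

Lemma projection0 : projection 0.
Proof.
split; last by rewrite mulr0.
apply: adjop_ext => x; apply: (@inner_inj R A) => z.
by rewrite -adjE inner0r inner0l.
Qed.

Lemma proj_on0 : proj_on [set 0] = 0.
Proof.
rewrite -(proj_onE projection0); congr proj_on.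
by apply/seteqP; split=> [x ->|_ [x _ <-]//]; exists x.
Qed.

End AdjointableOperators.

Notation "''L' ( H )" := (adjop H) (at level 8, format "''L' ( H )") : type_scope.

(* Main.v *)
Require Import Defs.
From HB Require Import structures.
From mathcomp Require Import all_boot all_order all_algebra.
From mathcomp Require Import complex.
From mathcomp Require Import all_classical all_reals all_analysis.
From mathcomp Require Import ring lra.

(** Let A be the algebra of bounded complex sequences, let H be the A-module
of pairs (x, y) in A x A with y_n -> 0, and let t_n = 1 / (n + 1).  Take for P
the projection onto the first axis, P(x, y) = (x, 0), and for Q the projection
whose n-th fibre is the orthogonal projection of C^2 onto the line spanned by
(1, t_n).

In every fibre P and Q project onto two distinct lines of the plane, so their
ranges meet in 0 only and so do their null spaces (lemmas range_cap0 and
null_cap0).  Each fibre even has a unitary carrying Q to 1 - P and P to 1 - Q.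
The obstruction is at infinity: since y_n -> 0, only the first axis survives
there, the lines spanned by (1, t_n) tend to it, and P and Q both become the
identity whereas 1 - P becomes 0.

Concretely, suppose that U Q U^* = 1 - P with U unitary and let e = (1, 0).
Then U Q e = (1 - P) U e lies in the second summand, so that its inner square
<U Q e, U Q e> is a sequence tending to 0.  But this inner square is also
<Q e, Q e> = <e, Q e>, whose n-th term 1 / (1 + t_n^2) is at least 1/2.  This is
lemma line_axis_compl_not_equiv; the first of the two equations asked of U is
thus already impossible.

Most of the work goes into showing that A is a C*-algebra and H a Hilbert
module.  Both carry a supremum norm over n of a Euclidean norm of the n-th
fibre, and are described by their real coordinates (the real and imaginary
parts of the entries), which gives a common proof of completeness. *)

Set Implicit Arguments.
Unset Strict Implicit.
Unset Printing Implicit Defensive.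

Import Order.TTheory GRing.Theory Num.Theory numFieldNormedType.Exports.
Import ComplexField.Normc.

Local Open Scope complex_scope.
Local Open Scope classical_set_scope.
Local Open Scope ring_scope.

(** * Completeness from real coordinates *)

Section Complete.
Context {R : realType} {M : normedModType R[i]} {T : Type}.

(** The coordinates of a Cauchy filter converge because the real numbers are
complete, and uniformly in the index because they are 1-Lipschitz.  What depends
on the space is left as hypotheses: the coordinates control the norm up to a
factor [K], and a uniform limit of coordinates is again the coordinates of a
point. *)
Lemma complete_by_coordinates (c : T -> M -> R) (K : R) :
    0 <= K ->
    (forall t x y, `|c t x - c t y|%:C <= `|x - y|) ->
    (forall x y (e : R), (forall t, `|c t x - c t y| <= e) ->
      `|x - y| <= (K * e)%:C) ->
    (forall f : T -> R,
      (forall e : R, 0 < e -> exists x, forall t, `|f t - c t x| <= e) ->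
      exists l, forall t, c t l = f t) ->
  forall F : set_system M, ProperFilter F -> cauchy F -> cvg F.
Proof.
move=> K0 c1 cK crep F FF Fc.
have small (e : R) : 0 < e -> exists x, F [set y | `|x - y| < e%:C].
  move=> e0; have eC : 0 < e%:C by rewrite ltcR.
  have /cauchyP /(_ _ eC) [x Fx] := Fc.
  exists x; move: Fx; apply: filterS => y.
  by rewrite -ball_normE.
have near_c t x y (e : R) : `|x - y| < e%:C -> `|c t x - c t y| < e.
  by move=> xy; rewrite -ltcR (le_lt_trans _ xy)// c1.
have cF t : cvg (c t @ F).
  apply: R_complete; apply: (@cauchy_exP R R) => e e0.
  have [x Fx] := small _ e0; exists (c t x).
  change (F (c t @^-1` ball (c t x) e)).
  by apply: filterS Fx => y /(near_c t).
pose f t : R := lim (c t @ F).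
(* The pointwise limit [f] inherits the bounds that hold along [F]. *)
have fx (e : R) x t : F [set y | `|x - y| < e%:C] -> `|f t - c t x| <= e.
  move=> Fx; apply/ler_addgt0Pr => d d0.
  have /cvgrPdist_lt /(_ _ d0) fd := cF t.
  near F => y.
  have h1 : `|f t - c t y| < d by near: y.
  have h2 : `|c t x - c t y| < e by apply: near_c; near: y.
  rewrite (le_trans (ler_distD (c t y) _ _))// addrC lerD// 1?ltW//.
  by rewrite distrC.
have [e e0|l lf] := crep f.
  by have [x Fx] := small _ e0; exists x => t; apply: fx.
apply/cvg_ex; exists l; apply/cvgrPdist_lt => eps.
rewrite ltcE => /= /andP[/eqP im0 re0].
(* A positive complex number is real. *)
have -> : eps = (complex.Re eps)%:C.
  by apply/eqP; rewrite eq_complex /= im0 !eqxx.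
move: (complex.Re eps) re0 => r r0.
have K1 : 0 < K + 1 by rewrite ltr_wpDl.
have [x Fx] := small (r / (K + 1)) (divr_gt0 r0 K1).
apply: (filterS _ Fx) => y /= xy.
have -> : r = K * (r / (K + 1)) + r / (K + 1).
  by rewrite -{2}[r / _]mul1r -mulrDl mulrC divfK// gt_eqF.
rewrite (le_lt_trans (ler_distD x _ _))// rmorphD ler_ltD//.
by apply: cK => t; rewrite lf; exact: fx Fx.
Unshelve. all: by end_near. Qed.

End Complete.

(** * Suprema of real sequences and the complex modulus *)

Section SupSeq.
Context {R : realType}.
Implicit Types (u v : nat -> R) (M : R).

Definition supseq u : R := sup (range u).

Lemma le_supseq u M n : (forall k, u k <= M) -> u n <= supseq u.
Proof.
move=> uM; apply: sup_upper_bound; last by exists n.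
by split; [exists (u n), n|exists M => _ [k _ <-]].
Qed.

Lemma supseq_le u M : (forall n, u n <= M) -> supseq u <= M.
Proof.
move=> uM; apply: ge_sup; first by exists (u 0%N), 0%N.
by move=> _ [k _ <-].
Qed.

Lemma supseq_ge0 u : (forall n, 0 <= u n) -> 0 <= supseq u.
Proof.
move=> u0; have [[_ [M uM]]|/sup_out s0] := pselect (has_sup (range u)).
  by apply: le_trans (u0 0%N) (@le_supseq _ M _ _) => k; apply: uM; exists k.
by rewrite /supseq s0.
Qed.

(** This carries both the C*-identity of bounded sequences and the relation
between the norm and the inner square of the module. *)
Lemma supseq_sqr u M : (forall n, 0 <= u n <= M) ->
  supseq (fun n => u n ^+ 2) = supseq u ^+ 2.
Proof.
move=> uM.
have u0 n : 0 <= u n by case/andP: (uM n).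
have {}uM n : u n <= M by case/andP: (uM n).
have s0 : 0 <= supseq (fun n => u n ^+ 2).
  by apply: supseq_ge0 => n; rewrite sqr_ge0.
apply/eqP; rewrite eq_le; apply/andP; split.
  apply: supseq_le => n; rewrite lerXn2r ?nnegrE ?supseq_ge0//.
  exact: le_supseq uM.
rewrite -(sqr_sqrtr s0) lerXn2r ?nnegrE ?supseq_ge0 ?sqrtr_ge0//.
apply: supseq_le => n; rewrite -(ger0_norm (u0 n)) -sqrtr_sqr ler_wsqrtr//.
apply: (@le_supseq (fun k => u k ^+ 2) (M ^+ 2)) => k.
by rewrite lerXn2r ?nnegrE ?(le_trans (u0 k) (uM k)).
Qed.

Lemma supseqZ u M k : (forall n, u n <= M) -> 0 <= k ->
  supseq (fun n => k * u n) = k * supseq u.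
Proof.
move=> uM; rewrite le_eqVlt => /predU1P[<-|k0].
  under eq_fun do rewrite mul0r.
  apply/eqP; rewrite mul0r eq_le supseq_ge0// andbT.
  exact: supseq_le.
apply/eqP; rewrite eq_le; apply/andP; split.
  apply: supseq_le => n; rewrite ler_pM2l//; exact: le_supseq uM.
rewrite mulrC -ler_pdivlMr//; apply: supseq_le => n.
rewrite ler_pdivlMr// mulrC.
by apply: (@le_supseq (fun n => k * u n) (k * M)) => m; rewrite ler_pM2l.
Qed.

End SupSeq.

Section Modulus.
Context {R : realType}.
Implicit Types (z : R[i]) (M : R).

Lemma norm_normc z : `|z| = (normc z)%:C. Proof. by []. Qed.

Lemma normc_ge0 z : 0 <= normc z.
Proof. by rewrite -ler0c -norm_normc. Qed.

Lemma normc_Re z : `|complex.Re z| <= normc z.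
Proof. by rewrite -lecR -norm_normc normc_ge_Re. Qed.

Lemma normc_Im z : `|complex.Im z| <= normc z.
Proof.
by case: z => a b /=; rewrite -sqrtr_sqr ler_wsqrtr// lerDr sqr_ge0.
Qed.

Lemma normc_le_coord z M :
  `|complex.Re z| <= M -> `|complex.Im z| <= M -> normc z <= 2 * M.
Proof.
case: z => a b /= aM bM; have M0 := le_trans (normr_ge0 a) aM.
rewrite -[2 * M]ger0_norm ?mulr_ge0// -sqrtr_sqr ler_wsqrtr//.
rewrite -(real_normK (num_real a)) -(real_normK (num_real b)).
have := normr_ge0 a; have := normr_ge0 b; nra.
Qed.

End Modulus.

(** * The C*-algebra of bounded complex sequences *)

Section BoundedSequences.
Context {R : realType}.
Implicit Types (f g : nat -> R[i]) (k : R[i]) (M : R).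

Definition bounded_seq : {pred nat -> R[i]} :=
  fun f => `[< exists M, forall n, normc (f n) <= M >].

Lemma bounded_submod : submod_closed bounded_seq.
Proof.
split; first by apply/asboolP; exists 0 => n; rewrite normc0.
move=> k f g /asboolP[M fM] /asboolP[N gN]; apply/asboolP.
exists (normc k * M + N) => n; rewrite (le_trans (le_normcD _ _))//.
by rewrite lerD// normcM ler_wpM2l ?normc_ge0.
Qed.

HB.instance Definition _ :=
  GRing.isSubmodClosed.Build R[i] (nat -> R[i]) bounded_seq bounded_submod.

End BoundedSequences.

Record linf (R : realType) := Linf {
  linf_fun :> nat -> R[i];
  _ : linf_fun \in bounded_seq
}.
HB.instance Definition _ (R : realType) := [isSub for @linf_fun R].
HB.instance Definition _ (R : realType) := [Choice of linf R by <:].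
HB.instance Definition _ (R : realType) :=
  [SubChoice_isSubLmodule of linf R by <:].

Section LinfTheory.
Context {R : realType}.
Implicit Types (f g : linf R) (k : R[i]) (M : R).

Lemma linfP f : exists M, forall n, normc (f n) <= M.
Proof. by case: f => f /= /asboolP. Qed.

Lemma linf_ext f g : f =1 g -> f = g.
Proof. by move=> fg; apply/val_inj/funext. Qed.

Definition linf_of (u : nat -> R[i]) M (uM : forall n, normc (u n) <= M) :=
  Linf (introT (asboolP _) (ex_intro _ M uM)).

Lemma linf0E n : (0 : linf R) n = 0. Proof. by []. Qed.
Lemma linfDE f g n : (f + g) n = f n + g n. Proof. by []. Qed.
Lemma linfBE f g n : (f - g) n = f n - g n. Proof. by []. Qed.
Lemma linfZE k f n : (k *: f) n = k * f n. Proof. by []. Qed.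

Definition linf_norm f : R := supseq (fun n => normc (f n)).

Lemma linf_norm_ub f n : normc (f n) <= linf_norm f.
Proof.
by have [M fM] := linfP f; apply: (@le_supseq _ (fun m => normc (f m)) M).
Qed.

Lemma linf_norm_le f M : (forall n, normc (f n) <= M) -> linf_norm f <= M.
Proof. exact: supseq_le. Qed.

Lemma linf_norm_ge0 f : 0 <= linf_norm f.
Proof. exact: le_trans (normc_ge0 _) (linf_norm_ub f 0). Qed.

Lemma linf_normD f g :
  (linf_norm (f + g))%:C <= (linf_norm f)%:C + (linf_norm g)%:C.
Proof.
rewrite -rmorphD lecR; apply: linf_norm_le => n.
by rewrite (le_trans (le_normcD _ _))// lerD// linf_norm_ub.
Qed.

Lemma linf_norm0_eq0 f : (linf_norm f)%:C = 0 -> f = 0.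
Proof.
move=> [f0]; apply: linf_ext => n; apply: eq0_normc; apply/eqP.
by rewrite eq_le normc_ge0 andbT -f0 linf_norm_ub.
Qed.

Lemma linf_normZ k f : (linf_norm (k *: f))%:C = `|k| * (linf_norm f)%:C.
Proof.
rewrite norm_normc -rmorphM; congr _%:C.
rewrite /linf_norm; under eq_fun do rewrite linfZE normcM.
by apply: (supseqZ (M := linf_norm f)) (normc_ge0 k) => n; apply: linf_norm_ub.
Qed.

HB.instance Definition _ := Lmodule_isNormed.Build R[i] (linf R)
  linf_normD linf_normZ linf_norm0_eq0.

Lemma linf_normE f : `|f| = (linf_norm f)%:C. Proof. by []. Qed.

Definition linf_coord (t : nat * bool) f : R :=
  if t.2 then complex.Re (f t.1) else complex.Im (f t.1).

Lemma linf_coordB t f g :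
  linf_coord t f - linf_coord t g = linf_coord t (f - g).
Proof. by rewrite /linf_coord linfBE !raddfB; case: ifP. Qed.

Lemma linf_coord_le t f : `|linf_coord t f| <= linf_norm f.
Proof.
rewrite (le_trans _ (linf_norm_ub f t.1))// /linf_coord.
by case: ifP => _; rewrite (normc_Re, normc_Im).
Qed.

Lemma normc_coord_le f n M :
  (forall t, `|linf_coord t f| <= M) -> normc (f n) <= 2 * M.
Proof.
move=> fM; apply: normc_le_coord.
  by have := fM (n, true).
by have := fM (n, false).
Qed.

(** A family of reals is the coordinates of a bounded sequence as soon as it
stays at bounded distance from the coordinates of one. *)
Lemma linf_rep (u : nat * bool -> R) M f :
  (forall t, `|u t - linf_coord t f| <= M) ->
  exists l : linf R, forall t, linf_coord t l = u t.
Proof.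
move=> ufM; pose l n := u (n, true) +i* u (n, false).
suff lM n : normc (l n) <= 2 * (M + linf_norm f).
  by exists (linf_of lM) => -[n []].
have uM t : `|u t| <= M + linf_norm f.
  rewrite -[u t](subrK (linf_coord t f)) (le_trans (ler_normD _ _))//.
  by rewrite lerD// linf_coord_le.
by apply: normc_le_coord; [have := uM (n, true)|have := uM (n, false)].
Qed.

Lemma linf_complete (F : set_system (linf R)) :
  ProperFilter F -> cauchy F -> cvg F.
Proof.
apply: (@complete_by_coordinates _ _ _ linf_coord 2).
- by [].
- by move=> t f g; rewrite linf_coordB linf_normE lecR linf_coord_le.
- move=> f g e fg; rewrite linf_normE lecR; apply: linf_norm_le => n.
  by apply: normc_coord_le => t; rewrite -linf_coordB.
- by move=> u /(_ 1 ltr01)[f] /linf_rep.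
Qed.

HB.instance Definition _ := Uniform_isComplete.Build (linf R) linf_complete.

Fact linf_mul_bound f g n : normc (f n * g n) <= linf_norm f * linf_norm g.
Proof. by rewrite normcM ler_pM ?normc_ge0 ?linf_norm_ub. Qed.

Lemma normc_conj (z : R[i]) : normc z^* = normc z.
Proof. by case: z => a b /=; rewrite sqrrN. Qed.

Fact linf_conj_bound f n : normc (f n)^* <= linf_norm f.
Proof. by rewrite normc_conj linf_norm_ub. Qed.

Definition linf_mul f g := linf_of (linf_mul_bound f g).
Definition linf_conj f := linf_of (linf_conj_bound f).

Fact linf_mulA f g h : linf_mul f (linf_mul g h) = linf_mul (linf_mul f g) h.
Proof. by apply: linf_ext => n /=; rewrite mulrA. Qed.

Fact linf_mulDl f g h : linf_mul (f + g) h = linf_mul f h + linf_mul g h.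
Proof. by apply: linf_ext => n /=; rewrite mulrDl. Qed.

Fact linf_mulDr f g h : linf_mul f (g + h) = linf_mul f g + linf_mul f h.
Proof. by apply: linf_ext => n /=; rewrite mulrDr. Qed.

Fact linf_scaleAl k f g : k *: linf_mul f g = linf_mul (k *: f) g.
Proof. by apply: linf_ext => n; rewrite linfZE /= mulrA. Qed.

Fact linf_scaleAr k f g : k *: linf_mul f g = linf_mul f (k *: g).
Proof. by apply: linf_ext => n; rewrite linfZE /= mulrCA. Qed.

Fact linf_normM f g : `|linf_mul f g| <= `|f| * `|g|.
Proof.
rewrite !linf_normE -rmorphM lecR; apply: linf_norm_le => n.
exact: linf_mul_bound.
Qed.

Fact linf_conjK f : linf_conj (linf_conj f) = f.
Proof. by apply: linf_ext => n /=; rewrite conjCK. Qed.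

Fact linf_conjD f g : linf_conj (f + g) = linf_conj f + linf_conj g.
Proof. by apply: linf_ext => n /=; rewrite rmorphD. Qed.

Fact linf_conjZ k f : linf_conj (k *: f) = (Num.conj k) *: linf_conj f.
Proof. by apply: linf_ext => n /=; rewrite rmorphM. Qed.

Fact linf_conjM f g :
  linf_conj (linf_mul f g) = linf_mul (linf_conj g) (linf_conj f).
Proof. by apply: linf_ext => n /=; rewrite rmorphM mulrC. Qed.

Fact linf_cstar f : `|linf_mul (linf_conj f) f| = `|f| ^+ 2.
Proof.
rewrite !linf_normE -rmorphXn; congr _%:C.
rewrite -(@supseq_sqr _ _ (linf_norm f)) => [|n]; last first.
  by rewrite normc_ge0 linf_norm_ub.
by congr supseq; apply/funext => n /=; rewrite normcM normc_conj.
Qed.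

HB.instance Definition _ := isCstarAlgebra.Build R (linf R)
  linf_mulA linf_mulDl linf_mulDr linf_scaleAl linf_scaleAr linf_normM
  linf_conjK linf_conjD linf_conjZ linf_conjM linf_cstar.

End LinfTheory.

(** * The Hilbert module of pairs with vanishing second component *)

Section VanishingSequences.
Context {R : realType}.
Implicit Types (f g : linf R) (k : R[i]) (M : R).

Definition vanishing f :=
  forall e : R, 0 < e -> \forall n \near \oo, normc (f n) <= e.

Lemma vanishing0 : vanishing 0.
Proof. by move=> e e0; apply: nearW => n; rewrite linf0E normc0 ltW. Qed.

Lemma vanishingD f g : vanishing f -> vanishing g -> vanishing (f + g).
Proof.
move=> f0 g0 e e0; have e2 : 0 < e / 2 by rewrite divr_gt0.
have := g0 _ e2; have := f0 _ e2; apply: filterS2 => n fe ge.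
by rewrite (le_trans (le_normcD _ _))// [leRHS]splitr lerD.
Qed.

(** The vanishing sequences form an ideal, so the pairs are stable under the
right action of the algebra and under the projection onto the lines. *)
Lemma vanishingM f g : vanishing f -> vanishing (linf_mul f g).
Proof.
move=> f0 e e0; have G : 0 < linf_norm g + 1.
  by rewrite ltr_wpDl// linf_norm_ge0.
have := f0 _ (divr_gt0 e0 G); apply: filterS => n fe /=.
rewrite normcM -[leRHS](divfK (lt0r_neq0 G)) ler_pM ?normc_ge0//.
by rewrite (le_trans (linf_norm_ub g n))// lerDl.
Qed.

Lemma vanishingZ k f : vanishing f -> vanishing (k *: f).
Proof.
have kM (n : nat) : normc k <= normc k by [].
have -> : k *: f = linf_mul f (@linf_of _ (fun=> k) _ kM).
  by apply: linf_ext => n; rewrite linfZE mulrC.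
exact: vanishingM.
Qed.

(** Closedness of the vanishing sequences makes the module complete. *)
Lemma vanishing_closed f :
  (forall e : R, 0 < e -> exists2 g, vanishing g & linf_norm (f - g) <= e) ->
  vanishing f.
Proof.
move=> fc e e0; have e2 : 0 < e / 2 by rewrite divr_gt0.
have [g g0 fg] := fc _ e2; have := g0 _ e2; apply: filterS => n ge.
have -> : f n = (f - g) n + g n by rewrite linfBE subrK.
rewrite (le_trans (le_normcD _ _))// [leRHS]splitr lerD//.
by rewrite (le_trans (linf_norm_ub _ _)).
Qed.

Definition second_vanishing : {pred linf R * linf R} :=
  fun x => `[< vanishing x.2 >].

Lemma second_vanishing_submod : submod_closed second_vanishing.
Proof.
split; first by apply/asboolP; apply: vanishing0.
move=> k x y /asboolP x0 /asboolP y0; apply/asboolP.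
by apply: vanishingD => //; apply: vanishingZ.
Qed.

HB.instance Definition _ := GRing.isSubmodClosed.Build R[i]
  (linf R * linf R)%type second_vanishing second_vanishing_submod.

End VanishingSequences.

Record hmod (R : realType) := HMod {
  hmod_pair :> linf R * linf R;
  _ : hmod_pair \in second_vanishing
}.
HB.instance Definition _ (R : realType) := [isSub for @hmod_pair R].
HB.instance Definition _ (R : realType) := [Choice of hmod R by <:].
HB.instance Definition _ (R : realType) :=
  [SubChoice_isSubLmodule of hmod R by <:].

Section HmodTheory.
Context {R : realType}.
Implicit Types (x y z : hmod R) (f g a b : linf R) (k : R[i]) (M : R).

Definition fst_hmod x : linf R := (hmod_pair x).1.
Definition snd_hmod x : linf R := (hmod_pair x).2.

Lemma snd_hmodP x : vanishing (snd_hmod x).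
Proof. by apply/asboolP; case: x. Qed.

Lemma hmod_ext x y :
  fst_hmod x = fst_hmod y -> snd_hmod x = snd_hmod y -> x = y.
Proof.
by move=> xy1 xy2; apply: val_inj; rewrite /= [LHS]surjective_pairing
  [RHS]surjective_pairing; congr pair.
Qed.

Definition hmod_of f g (g0 : vanishing g) : hmod R :=
  HMod (introT (asboolP (vanishing (f, g).2)) g0).

Definition fiber_norm x n : R :=
  Num.sqrt (normc (fst_hmod x n) ^+ 2 + normc (snd_hmod x n) ^+ 2).

Lemma fiber_norm_ge0 x n : 0 <= fiber_norm x n.
Proof. exact: sqrtr_ge0. Qed.

(** As the modulus of a complex number, the fibre norm inherits the triangle
inequality of the complex plane. *)
Lemma fiber_normE x n :
  fiber_norm x n = normc (normc (fst_hmod x n) +i* normc (snd_hmod x n)).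
Proof. by []. Qed.

Lemma fst_le_fiber_norm x n : normc (fst_hmod x n) <= fiber_norm x n.
Proof.
rewrite -{1}(ger0_norm (normc_ge0 (fst_hmod x n))) fiber_normE.
exact: (normc_Re (normc _ +i* normc _)).
Qed.

Lemma snd_le_fiber_norm x n : normc (snd_hmod x n) <= fiber_norm x n.
Proof.
rewrite -{1}(ger0_norm (normc_ge0 (snd_hmod x n))) fiber_normE.
exact: (normc_Im (normc _ +i* normc _)).
Qed.

Lemma fiber_norm_bound x n :
  fiber_norm x n <= linf_norm (fst_hmod x) + linf_norm (snd_hmod x).
Proof.
have hf := linf_norm_ub (fst_hmod x) n; have hs := linf_norm_ub (snd_hmod x) n.
have f0 := normc_ge0 (fst_hmod x n); have s0 := normc_ge0 (snd_hmod x n).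
rewrite -[leRHS]ger0_norm ?addr_ge0 ?(le_trans _ hf) ?(le_trans _ hs)//.
rewrite -sqrtr_sqr ler_wsqrtr//; nra.
Qed.

Lemma fst_hmodD x y : fst_hmod (x + y) = fst_hmod x + fst_hmod y.
Proof. by []. Qed.
Lemma snd_hmodD x y : snd_hmod (x + y) = snd_hmod x + snd_hmod y.
Proof. by []. Qed.
Lemma fst_hmodZ k x : fst_hmod (k *: x) = k *: fst_hmod x. Proof. by []. Qed.
Lemma snd_hmodZ k x : snd_hmod (k *: x) = k *: snd_hmod x. Proof. by []. Qed.

Lemma normc_quadrant (a b c d : R) : 0 <= a <= c -> 0 <= b <= d ->
  normc (a +i* b) <= normc (c +i* d).
Proof.
move=> /andP[a0 ac] /andP[b0 bd] /=; rewrite ler_wsqrtr// lerD//.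
  by rewrite lerXn2r ?nnegrE// (le_trans a0).
by rewrite lerXn2r ?nnegrE// (le_trans b0).
Qed.

Lemma fiber_normD x y n :
  fiber_norm (x + y) n <= fiber_norm x n + fiber_norm y n.
Proof.
rewrite !fiber_normE fst_hmodD snd_hmodD !linfDE.
apply: le_trans (le_normcD _ _).
by apply: normc_quadrant; rewrite normc_ge0 le_normcD.
Qed.

Lemma fiber_normZ k x n : fiber_norm (k *: x) n = normc k * fiber_norm x n.
Proof.
rewrite /fiber_norm fst_hmodZ snd_hmodZ !linfZE !normcM !exprMn -mulrDr.
by rewrite sqrtrM ?sqr_ge0// sqrtr_sqr ger0_norm ?normc_ge0.
Qed.

Definition hmod_norm x : R := supseq (fiber_norm x).

Lemma hmod_norm_ub x n : fiber_norm x n <= hmod_norm x.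
Proof. exact: le_supseq (fiber_norm_bound x). Qed.

Lemma hmod_norm_le x M : (forall n, fiber_norm x n <= M) -> hmod_norm x <= M.
Proof. exact: supseq_le. Qed.

Lemma hmod_normD x y :
  (hmod_norm (x + y))%:C <= (hmod_norm x)%:C + (hmod_norm y)%:C.
Proof.
rewrite -rmorphD lecR; apply: hmod_norm_le => n.
by rewrite (le_trans (fiber_normD _ _ _))// lerD// hmod_norm_ub.
Qed.

Lemma linf_fst_norm_le x : linf_norm (fst_hmod x) <= hmod_norm x.
Proof.
apply: linf_norm_le => n.
exact: le_trans (fst_le_fiber_norm _ _) (hmod_norm_ub _ _).
Qed.

Lemma linf_snd_norm_le x : linf_norm (snd_hmod x) <= hmod_norm x.
Proof.
apply: linf_norm_le => n.
exact: le_trans (snd_le_fiber_norm _ _) (hmod_norm_ub _ _).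
Qed.

Lemma hmod_norm0_eq0 x : (hmod_norm x)%:C = 0 -> x = 0.
Proof.
move=> [x0]; have x00 : hmod_norm x <= 0 by rewrite x0.
have z f : linf_norm f <= 0 -> f = 0.
  move=> f0; apply: linf_norm0_eq0; congr _%:C; apply/eqP.
  by rewrite eq_le f0 linf_norm_ge0.
by apply: hmod_ext; apply: z; apply: le_trans x00;
  [exact: linf_fst_norm_le|exact: linf_snd_norm_le].
Qed.

Lemma hmod_normZ k x : (hmod_norm (k *: x))%:C = `|k| * (hmod_norm x)%:C.
Proof.
rewrite norm_normc -rmorphM; congr _%:C; rewrite /hmod_norm.
have /funext -> := fiber_normZ k x.
by apply: (supseqZ (M := hmod_norm x)) (normc_ge0 k) => n; apply: hmod_norm_ub.
Qed.

HB.instance Definition _ := Lmodule_isNormed.Build R[i] (hmod R)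
  hmod_normD hmod_normZ hmod_norm0_eq0.

Lemma hmod_normE x : `|x| = (hmod_norm x)%:C. Proof. by []. Qed.

Definition hmod_coord (t : bool * (nat * bool)) x : R :=
  linf_coord t.2 (if t.1 then fst_hmod x else snd_hmod x).

Lemma hmod_coordB t x y :
  hmod_coord t x - hmod_coord t y = hmod_coord t (x - y).
Proof. by rewrite /hmod_coord linf_coordB; case: ifP. Qed.

Lemma hmod_coord_le t x : `|hmod_coord t x| <= hmod_norm x.
Proof.
rewrite (le_trans (linf_coord_le _ _))//.
by case: ifP => _; [exact: linf_fst_norm_le|exact: linf_snd_norm_le].
Qed.

Lemma hmod_complete (F : set_system (hmod R)) :
  ProperFilter F -> cauchy F -> cvg F.
Proof.
apply: (@complete_by_coordinates _ _ _ hmod_coord 4).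
- by [].
- by move=> t x y; rewrite hmod_coordB hmod_normE lecR hmod_coord_le.
- move=> x y e xy; rewrite hmod_normE lecR; apply: hmod_norm_le => n.
  rewrite (le_trans (fiber_norm_bound _ _))//.
  rewrite (_ : 4 * e = 2 * e + 2 * e); last by ring.
  rewrite lerD//; apply: linf_norm_le => m; apply: normc_coord_le => t.
    by have := xy (true, t); rewrite hmod_coordB.
  by have := xy (false, t); rewrite hmod_coordB.
- move=> u uc; have [x ux] := uc 1 ltr01.
  have [f fu] := linf_rep (fun t => ux (true, t)).
  have [g gu] := linf_rep (fun t => ux (false, t)).
  suff g0 : vanishing g.
    by exists (hmod_of f g0) => -[[] t]; [exact: fu|exact: gu].
  apply: vanishing_closed => e e0.
  have [y uy] := uc _ (divr_gt0 e0 (ltr0Sn _ 1)).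
  exists (snd_hmod y); first exact: snd_hmodP.
  apply: linf_norm_le => n; rewrite -[e](@divfK _ 2) ?pnatr_eq0// mulrC.
  apply: normc_coord_le => t; rewrite -linf_coordB gu.
  exact: (uy (false, t)).
Qed.

HB.instance Definition _ := Uniform_isComplete.Build (hmod R) hmod_complete.

End HmodTheory.

(** * The inner product *)

Section ComplexConj.
Context {R : realType}.
Implicit Types z t : R[i].

(* [R[i]] has two convertible conjugations, [conjc] and [Num.conj].  Rewriting
   with [rmorphD] or [rmorphM] mixes them; these equations keep to [Num.conj]. *)
Lemma conj_add z t : (z + t)^* = z^* + t^*. Proof. exact: rmorphD. Qed.
Lemma conj_mul z t : (z * t)^* = z^* * t^*. Proof. exact: rmorphM. Qed.
Lemma conj_real (r : R) : (r%:C)^* = r%:C. Proof. exact: conjc_real. Qed.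

End ComplexConj.

Section HmodInner.
Context {R : realType}.
Implicit Types (x y z : hmod R) (f g a b : linf R) (k : R[i]).

Definition hmod_ract x a : hmod R :=
  hmod_of (linf_mul (fst_hmod x) a) (vanishingM a (snd_hmodP x)).

Definition hmod_inner x y : linf R :=
  linf_mul (linf_conj (fst_hmod x)) (fst_hmod y) +
  linf_mul (linf_conj (snd_hmod x)) (snd_hmod y).

Lemma hmod_innerE x y n : hmod_inner x y n =
  (fst_hmod x n)^* * fst_hmod y n + (snd_hmod x n)^* * snd_hmod y n.
Proof. by []. Qed.

Lemma hmod_inner_self x n : hmod_inner x x n = (fiber_norm x n ^+ 2)%:C.
Proof.
rewrite hmod_innerE mulrC -normCK [_^* * _]mulrC -normCK !norm_normc.
by rewrite sqr_sqrtr ?addr_ge0 ?sqr_ge0// rmorphD !rmorphXn.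
Qed.

Lemma normc_real (r : R) : 0 <= r -> normc r%:C = r.
Proof. by move=> r0 /=; rewrite expr0n addr0 sqrtr_sqr ger0_norm. Qed.

Fact hmod_ractDl x y a : hmod_ract (x + y) a = hmod_ract x a + hmod_ract y a.
Proof. by apply: hmod_ext; rewrite (fst_hmodD, snd_hmodD) -linf_mulDl. Qed.

Fact hmod_ractDr x a b : hmod_ract x (a + b) = hmod_ract x a + hmod_ract x b.
Proof. by apply: hmod_ext; rewrite (fst_hmodD, snd_hmodD) -linf_mulDr. Qed.

Fact hmod_ractA x a b : hmod_ract x (cmul a b) = hmod_ract (hmod_ract x a) b.
Proof. by apply: hmod_ext; apply: linf_mulA. Qed.

Fact hmod_ractZl k x a : k *: hmod_ract x a = hmod_ract (k *: x) a.
Proof.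
by apply: hmod_ext; rewrite (fst_hmodZ, snd_hmodZ); apply: linf_scaleAl.
Qed.

Fact hmod_ractZr k x a : k *: hmod_ract x a = hmod_ract x (k *: a).
Proof.
by apply: hmod_ext; rewrite (fst_hmodZ, snd_hmodZ); apply: linf_scaleAr.
Qed.

Fact hmod_innerDr x y z :
  hmod_inner x (y + z) = hmod_inner x y + hmod_inner x z.
Proof. by rewrite /hmod_inner fst_hmodD snd_hmodD !linf_mulDr addrACA. Qed.

Fact hmod_innerZr k x y : hmod_inner x (k *: y) = k *: hmod_inner x y.
Proof. by rewrite /hmod_inner fst_hmodZ snd_hmodZ -!linf_scaleAr -scalerDr. Qed.

Fact hmod_inner_ract x y a :
  hmod_inner x (hmod_ract y a) = cmul (hmod_inner x y) a.
Proof.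
apply: linf_ext => n; rewrite hmod_innerE -[RHS]/(hmod_inner x y n * a n).
by rewrite hmod_innerE mulrDl -!mulrA.
Qed.

Fact hmod_inner_star x y : cstar (hmod_inner x y) = hmod_inner y x.
Proof.
apply: linf_ext => n; rewrite -[LHS]/((hmod_inner x y n)^*) !hmod_innerE.
by rewrite conj_add !conj_mul !conjCK mulrC [snd_hmod _ _ * _]mulrC.
Qed.

Fact fiber_norm_linf_bound x n :
  normc (fiber_norm x n)%:C <= hmod_norm x.
Proof. by rewrite normc_real ?fiber_norm_ge0 ?hmod_norm_ub. Qed.

(** The positive square root of the inner square is the sequence of the fibre
norms. *)
Fact hmod_inner_ge0 x : cpositive (hmod_inner x x).
Proof.
exists (linf_of (fiber_norm_linf_bound x)); apply: linf_ext => n.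
rewrite hmod_inner_self -[RHS]/((fiber_norm x n)%:C^* * (fiber_norm x n)%:C).
by rewrite conj_real -rmorphM.
Qed.

Fact hmod_inner_norm x : `|x| ^+ 2 = `|hmod_inner x x|.
Proof.
rewrite hmod_normE linf_normE -rmorphXn; congr _%:C.
rewrite /hmod_norm /linf_norm -(@supseq_sqr _ _ (hmod_norm x)) => [|n].
  congr supseq; apply/funext => n.
  by rewrite hmod_inner_self normc_real ?sqr_ge0.
by rewrite fiber_norm_ge0 hmod_norm_ub.
Qed.

Fact hmod_inner_eq0 x : hmod_inner x x = 0 -> x = 0.
Proof.
move=> x0; apply/eqP; rewrite -normr_eq0 -sqrf_eq0 hmod_inner_norm x0.
by rewrite normr0.
Qed.

HB.instance Definition _ := isHilbertModule.Build R (linf R) (hmod R)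
  hmod_ractDl hmod_ractDr hmod_ractA hmod_ractZl hmod_ractZr
  hmod_innerDr hmod_innerZr hmod_inner_ract hmod_inner_star hmod_inner_ge0
  hmod_inner_eq0 hmod_inner_norm.

End HmodInner.

(** * The two projections *)

Section SelfAdjoint.
Context {R : realType} {A : cstarAlgType R} (H : hilbertModType A).

Lemma adjop_map0 (T : 'L(H)) : T 0 = 0.
Proof. by apply: (addrI (T 0)); rewrite -adjopD !addr0. Qed.

Lemma projection_sym_idem (T : 'L(H)) :
  adjoint_pair T T -> (forall x, T (T x) = T x) -> projection T.
Proof.
move=> Tsym Tidem; split; last first.
  by apply: adjop_ext => x; rewrite -[RHS]/(T (T x)).
by apply: adjop_ext => x; apply: (@inner_inj R A) => z; rewrite -Tsym adjE.
Qed.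

End SelfAdjoint.

Section TwoLines.
Context {R : realType}.
Implicit Types (x y : hmod R).

(** [weight n *: (1, slope n)] is the orthogonal projection of [(1, 0)] onto the
line spanned by [(1, slope n)].  The slopes are nonzero, so that the line is
never the first axis, and tend to 0, so that the projections onto the lines act
on the module. *)
Definition slope (n : nat) : R := n.+1%:R^-1.
Definition weight (n : nat) : R := (1 + slope n ^+ 2)^-1.

Lemma slope_gt0 n : 0 < slope n. Proof. by rewrite invr_gt0 ltr0n. Qed.

Lemma slope_le1 n : slope n <= 1.
Proof. by rewrite invf_le1 ?ltr0n// ler1n. Qed.

Lemma den_gt0 n : 0 < 1 + slope n ^+ 2.
Proof. by rewrite ltr_wpDr ?sqr_ge0. Qed.

Lemma weightE n : weight n * (1 + slope n ^+ 2) = 1.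
Proof. by rewrite mulVf// gt_eqF ?den_gt0. Qed.

Lemma weight_ge n : 2^-1 <= weight n.
Proof.
rewrite lef_pV2 ?posrE ?den_gt0// (_ : 2 = 1 + 1)// lerD2l.
by rewrite expr_le1 ?slope_le1 ?ltW ?slope_gt0.
Qed.

Lemma weight_le1 n : weight n <= 1.
Proof. by rewrite invf_le1 ?den_gt0// lerDl sqr_ge0. Qed.

Fact slope_bound n : normc (slope n)%:C <= 1.
Proof. by rewrite normc_real ?slope_le1 ?ltW ?slope_gt0. Qed.

Fact weight_bound n : normc (weight n)%:C <= 1.
Proof. by rewrite normc_real ?weight_le1// (le_trans _ (weight_ge n)). Qed.

Definition slopes : linf R := linf_of slope_bound.
Definition weights : linf R := linf_of weight_bound.

Lemma slopes_vanishing : vanishing slopes.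
Proof.
move=> e e0; have := cvg_harmonic (R := R).
move=> /cvgrPdist_le /(_ _ e0); apply: filterS => n.
rewrite sub0r normrN => se; rewrite -[slopes n]/((slope n)%:C).
by rewrite normc_real ?(le_trans (ler_norm _) se)// ltW ?slope_gt0.
Qed.

Definition axis_fun x : hmod R := hmod_of (fst_hmod x) (@vanishing0 R).

Definition line_coef x : linf R :=
  linf_mul weights (fst_hmod x + linf_mul slopes (snd_hmod x)).

Definition line_fun x : hmod R :=
  hmod_of (line_coef x) (vanishingM (line_coef x) slopes_vanishing).

Lemma fst_axis x : fst_hmod (axis_fun x) = fst_hmod x. Proof. by []. Qed.
Lemma snd_axis x : snd_hmod (axis_fun x) = 0. Proof. by []. Qed.
Lemma fst_line x n : fst_hmod (line_fun x) n =
  (weight n)%:C * (fst_hmod x n + (slope n)%:C * snd_hmod x n).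
Proof. by []. Qed.
Lemma snd_line x n :
  snd_hmod (line_fun x) n = (slope n)%:C * fst_hmod (line_fun x) n.
Proof. by []. Qed.

Lemma axis_sym : adjoint_pair axis_fun axis_fun.
Proof.
move=> x y; apply: linf_ext => n; rewrite !hmod_innerE !fst_axis !snd_axis.
by rewrite !linf0E rmorph0 mul0r mulr0.
Qed.

Lemma axis_idem x : axis_fun (axis_fun x) = axis_fun x.
Proof. exact: hmod_ext. Qed.

Lemma line_sym : adjoint_pair line_fun line_fun.
Proof.
move=> x y; apply: linf_ext => n; rewrite !hmod_innerE !snd_line !fst_line.
by rewrite !(conj_mul, conj_add, conj_real); ring.
Qed.

Lemma line_idem x : line_fun (line_fun x) = line_fun x.
Proof.
have idem : line_coef (line_fun x) = line_coef x.
  apply: linf_ext => n; rewrite -[LHS]/(fst_hmod (line_fun (line_fun x)) n).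
  rewrite fst_line snd_line -[line_coef x n]/(fst_hmod (line_fun x) n).
  rewrite mulrA -{1}[fst_hmod _ _]mul1r -mulrDl mulrA -expr2.
  rewrite -rmorphXn -(rmorph1 (real_complex R)) -rmorphD -rmorphM.
  by rewrite weightE mul1r.
by apply: hmod_ext => //; rewrite /snd_hmod /= idem.
Qed.

Definition axis_proj : 'L(hmod R) := AdjOp (ex_intro _ _ axis_sym).
Definition line_proj : 'L(hmod R) := AdjOp (ex_intro _ _ line_sym).

Lemma axis_projection : projection axis_proj.
Proof. exact: (@projection_sym_idem _ _ _ axis_proj axis_sym axis_idem). Qed.

Lemma line_projection : projection line_proj.
Proof. exact: (@projection_sym_idem _ _ _ line_proj line_sym line_idem). Qed.

Lemma realC_neq0 (r : R) : 0 < r -> r%:C != 0.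
Proof. by move=> r0; rewrite eq_complex /= negb_and gt_eqF. Qed.

Lemma range_cap0 : range line_proj `&` range axis_proj = [set 0].
Proof.
apply/seteqP; split=> [x [[y _ yx] [z _ zx]]|_ ->]; last first.
  by split; exists 0 => //; apply: adjop_map0.
have x2 : snd_hmod x = 0 by rewrite -zx.
have x1 : fst_hmod x = 0.
  apply: linf_ext => n; have /eqP := snd_line y n.
  rewrite -[line_fun y]/(line_proj y) yx x2 linf0E eq_sym mulf_eq0.
  by rewrite (negPf (realC_neq0 (slope_gt0 n))) => /eqP.
exact: hmod_ext.
Qed.

Lemma null_cap0 : null_space line_proj `&` null_space axis_proj = [set 0].
Proof.
apply/seteqP; split=> [x [/= Qx Px]|_ ->]; last first.
  by split; apply: adjop_map0.
have x1 : fst_hmod x = 0 by rewrite -fst_axis [axis_fun x]Px.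
have x2 : snd_hmod x = 0.
  apply: linf_ext => n; have /eqP := fst_line x n.
  rewrite [line_fun x]Qx x1 linf0E add0r eq_sym !mulf_eq0.
  rewrite (negPf (realC_neq0 (slope_gt0 n))) (negPf (realC_neq0 _)).
    by move=> /eqP.
  by rewrite (lt_le_trans _ (weight_ge n)).
exact: hmod_ext.
Qed.

Fact one_bound (n : nat) : normc (1 : R[i]) <= 1.
Proof. by rewrite normc1. Qed.

Definition axis_vec : hmod R := hmod_of (linf_of one_bound) (@vanishing0 R).

(** The vector [U Q (1, 0)] would lie in the range of [1 - P], where inner
squares vanish at infinity, but [U] is isometric and the inner square of
[Q (1, 0)] is the sequence of the weights, which are at least 1/2. *)
Lemma line_axis_compl_not_equiv (U : 'L(hmod R)) : unitary U ->
  U * line_proj * adj U <> 1 - axis_proj.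
Proof.
move=> [UU _] UQ; pose e := line_proj axis_vec; pose v := U e.
have v1 : fst_hmod v = 0.
  have -> : v = U axis_vec - axis_proj (U axis_vec).
    have : U * line_proj = (1 - axis_proj) * U.
      by rewrite -UQ -[RHS]mulrA UU mulr1.
    by move=> /(congr1 (fun T : 'L(hmod R) => T axis_vec)).
  by rewrite fst_hmodD /= addrN.
have vw n : hmod_inner v v n = (weight n)%:C.
  have -> : hmod_inner v v = hmod_inner e e.
    rewrite -[LHS]/(inner (U e) (U e)) adjE.
    by rewrite -[adj U (U e)]/((adj U * U) e) UU.
  rewrite -[hmod_inner e e]/(inner (line_fun axis_vec) (line_fun axis_vec)).
  rewrite line_sym line_idem -[inner _ _]/(hmod_inner _ _).
  have e1 : fst_hmod axis_vec n = 1 by [].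
  have e2 : snd_hmod axis_vec n = 0 by [].
  rewrite hmod_innerE fst_line e1 e2 conjC1 conjC0 mul0r mulr0 !addr0.
  by rewrite mul1r mulr1.
have half_gt0 : (0 : R) < 2^-1 by rewrite invr_gt0.
(* At such an [n] the inner square of [v] is at most 1/4. *)
have [n v2] := filter_ex (snd_hmodP v half_gt0).
have := vw n; rewrite hmod_inner_self /fiber_norm v1 linf0E normc0 expr0n add0r.
rewrite sqr_sqrtr ?sqr_ge0// => /complexI w2.
have := weight_ge n; rewrite -w2; have := normc_ge0 (snd_hmod v n); nra.
Qed.

End TwoLines.

Theorem theorem3p4 (R : realType) :
  exists (A : cstarAlgType R) (H : hilbertModType A) (P Q : 'L(H)),
    let rng : set H := range Q `&` range P in
    let nul : set H := null_space Q `&` null_space P in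
    [/\ projection P, projection Q, rng = [set 0], nul = [set 0] &
      ~ exists U : 'L(H),
        [/\ unitary U,
            U * (Q - proj_on rng) * adj U = 1 - P - proj_on nul &
            U * (P - proj_on rng) * adj U = 1 - Q - proj_on nul]].
Proof.
exists (linf R), (hmod R), axis_proj, line_proj => rng nul.
have rng0 : rng = [set 0] by apply: range_cap0.
have nul0 : nul = [set 0] by apply: null_cap0.
split=> //; [exact: axis_projection|exact: line_projection|].
case=> U [Uu + _]; rewrite rng0 nul0 proj_on0 !subr0.
exact: line_axis_compl_not_equiv.
Qed.
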